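(* Let $k$ be a field, $A$ an associative $k$-algebra, $B$ a commutative $k$-algebra, $\varepsilon:B\to A$ a morphism of $k$-algebras such that $\varepsilon(B)\subset\mathcal Z(A)$, and $M$ an $A$-bimodule. Then $(C^n((A,B,\varepsilon);M),\delta_n^\varepsilon)$ is a complex, i.e. $\delta_{n+1}^\varepsilon\delta_n^\varepsilon=0$. Its homology is denoted by $H^n((A,B,\varepsilon);M)$ and is called the secondary cohomology of the triple $(A,B,\varepsilon)$ with coefficients in $M$.
   Context: Here $\otimes=\otimes_k$ and $\mathcal Z(A)$ is the center of $A$. For $n\ge 0$ put $$C^n((A,B,\varepsilon);M)=\mathrm{Hom}_k\bigl(A^{\otimes n}\otimes B^{\otimes \frac{n(n-1)}{2}},M\bigr).$$ A pure tensor of $A^{\otimes n}\otimes B^{\otimes\frac{n(n-1)}2}$ is written $\bigl((a_i)_{0\le i\le n-1};(b_{u,v})_{0\le u<v\le n-1}\bigr)$ with $a_i\in A$, $b_{u,v}\in B$; it is pictured as an upper triangular tensor matrix with the $a_i$ on the diagonal, the $b_{u,v}$ above the diagonal, and $1$ below the diagonal. The map $\delta_n^\varepsilon:C^n((A,B,\varepsilon);M)\to C^{n+1}((A,B,\varepsilon);M)$ is defined on $x=\bigl((a_i)_{0\le i\le n};(b_{u,v})_{0\le u<v\le n}\bigr)$ by $$\delta_n^\varepsilon(f)(x)=a_0\,\varepsilon(b_{0,1}b_{0,2}\cdots b_{0,n})\,f\bigl((a_i)_{1\le i\le n};(b_{u,v})_{1\le u<v\le n}\bigr)+\sum_{i=1}^n(-1)^i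 f(d_i x)$$ $$\qquad+(-1)^{n+1}\varepsilon(b_{0,n}b_{1,n}\cdots b_{n-1,n})\,f\bigl((a_i)_{0\le i\le n-1};(b_{u,v})_{0\le u<v\le n-1}\bigr)\,a_n .$$ In the first term the indices are shifted down by one to range over $0,\dots,n-1$. For $1\le i\le n$, $d_ix=\bigl((a'_j)_{0\le j\le n-1};(b'_{u,v})_{0\le u<v\le n-1}\bigr)$ is obtained by multiplying row $i$ into row $i-1$ and column $i$ into column $i-1$ of the tensor matrix (rows and columns numbered from $0$ to $n$), explicitly $$a'_j=a_j\ (j<i-1),\qquad a'_{i-1}=\varepsilon(b_{i-1,i})a_{i-1}a_i,\qquad a'_j=a_{j+1}\ (j\ge i),$$ $$b'_{u,v}=\begin{cases} b_{u,v} & u<v<i-1\\ b_{u,i-1}b_{u,i} & u<v=i-1\\ b_{u,v+1} & u<i-1<v\\ b_{i-1,v+1}b_{i,v+1} & u=i-1<v\\ b_{u+1,v+1} & i-1<u<v.\end{cases}$$ Empty products in $B$ equal $1$.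
   Formalization: The A-bimodule M is also assumed B-symmetric, i.e. ε(b)m = mε(b) for all b in B, m in M; without it the claim fails, since (δ_1δ_0 m)((1,1);b) = mε(b) − ε(b)m, e.g. A = B = k[x], ε = id, M = k with x acting by 0 on the left and 1 on the right. *)

(* Defs.v *)
From HB Require Import structures.
From mathcomp Require Import all_boot all_algebra.
From mathcomp Require Import boolp freeg.
From mathcomp Require Import zify.

Set Implicit Arguments.
Unset Strict Implicit.
Unset Printing Implicit Defensive.

Import GRing.Theory.
Local Open Scope ring_scope.
Local Open Scope quotient_scope.

Section LinearLmodule.
Context (k : fieldType) (U V : lmodType k).
Implicit Types f g h : {linear U -> V}.

Lemma linear_ext f g : f =1 g -> f = g.
Proof.
move=> fg; have {fg}: (f : U -> V) = g by apply/funext.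
case: f g => f [[fD] [fZ]] [g [[gD] [gZ]]] /= fg.
subst g; by rewrite (Prop_irrelevance gD fD) (Prop_irrelevance gZ fZ).
Qed.

HB.instance Definition _ := gen_eqMixin {linear U -> V}.
HB.instance Definition _ := gen_choiceMixin {linear U -> V}.

Let lzero : {linear U -> V} := \0.
Let lopp f : {linear U -> V} := \- f.
Let ladd f g : {linear U -> V} := f \+ g.
Let lscale (c : k) f : {linear U -> V} := c \*: f.

Let laddA : associative ladd.
Proof. by move=> f g h; apply: linear_ext => x /=; rewrite addrA. Qed.
Let laddC : commutative ladd.
Proof. by move=> f g; apply: linear_ext => x /=; rewrite addrC. Qed.
Let ladd0 : left_id lzero ladd.
Proof. by move=> f; apply: linear_ext => x /=; rewrite add0r. Qed.
Let laddN : left_inverse lzero lopp ladd.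
Proof. by move=> f; apply: linear_ext => x /=; rewrite addNr. Qed.

HB.instance Definition _ :=
  GRing.isZmodule.Build {linear U -> V} laddA laddC ladd0 laddN.

Let lscaleA a b f : lscale a (lscale b f) = lscale (a * b) f.
Proof. by apply: linear_ext => x /=; rewrite scalerA. Qed.
Let lscale1 : left_id 1 lscale.
Proof. by move=> f; apply: linear_ext => x /=; rewrite scale1r. Qed.
Let lscaleDr : right_distributive lscale +%R.
Proof. by move=> a f g; apply: linear_ext => x /=; rewrite scalerDr. Qed.
Let lscaleDl f : {morph lscale^~ f : a b / a + b}.
Proof. by move=> a b; apply: linear_ext => x /=; rewrite scalerDl. Qed.

HB.instance Definition _ :=
  GRing.Zmodule_isLmodule.Build k {linear U -> V}
    lscaleA lscale1 lscaleDr lscaleDl.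

Lemma linear0E x : (0 : {linear U -> V}) x = 0. Proof. by []. Qed.
Lemma linearNE f x : (- f) x = - f x. Proof. by []. Qed.
Lemma linearDE f g x : (f + g) x = f x + g x. Proof. by []. Qed.
Lemma linearZE a f x : (a *: f) x = a *: f x. Proof. by []. Qed.

End LinearLmodule.

Section QuotientModule.
Context (k : fieldType) (V : lmodType k) (S : submodClosed V).

(* A submodClosed predicate over a ring is also closed under opposites, but the
   library does not record it as a zmodClosed one. *)
Definition submod_mem : V -> bool := fun x => x \in S.
HB.instance Definition _ := GRing.isZmodClosed.Build V submod_mem
  (GRing.subsemimod_closedB (GRing.subsemimodClosedP S)).
Definition zmod_of_submod := GRing.ZmodClosed.clone V submod_mem _.

Definition quotmod := Quotient.quot zmod_of_submod.
HB.instance Definition _ := GRing.Zmodule.on quotmod.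

Definition quot_proj (x : V) : quotmod := \pi_(Quotient.quot zmod_of_submod) x.

Lemma quot_proj_eq x y : (quot_proj x = quot_proj y) <-> (x - y \in S).
Proof.
rewrite -[x - y \in S]/(x - y \in zmod_of_submod) Quotient.idealrBE.
by split=> [h|/eqP]; [apply/eqP|].
Qed.

Lemma quot_proj_surj (q : quotmod) : exists x, q = quot_proj x.
Proof. by exists (repr q); rewrite /quot_proj reprK. Qed.

Let projD : {morph quot_proj : x y / x + y}.
Proof. by move=> x y; rewrite /quot_proj !piE. Qed.

Let qscale (c : k) (q : quotmod) : quotmod := quot_proj (c *: repr q).

Let qscaleE c x : qscale c (quot_proj x) = quot_proj (c *: x).
Proof.
apply/quot_proj_eq; rewrite -scalerBr rpredZ //.
by apply/quot_proj_eq; rewrite /quot_proj reprK.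
Qed.

Let qscaleA a b q : qscale a (qscale b q) = qscale (a * b) q.
Proof. by case: (quot_proj_surj q) => x ->; rewrite !qscaleE scalerA. Qed.
Let qscale1 : left_id 1 qscale.
Proof. by move=> q; case: (quot_proj_surj q) => x ->; rewrite qscaleE scale1r. Qed.
Let qscaleDr : right_distributive qscale +%R.
Proof.
move=> a q r; case: (quot_proj_surj q) (quot_proj_surj r) => x -> [y ->].
by rewrite -projD !qscaleE scalerDr projD.
Qed.
Let qscaleDl q : {morph qscale^~ q : a b / a + b}.
Proof.
by move=> a b; case: (quot_proj_surj q) => x ->; rewrite !qscaleE scalerDl projD.
Qed.

HB.instance Definition _ := GRing.Zmodule_isLmodule.Build k quotmod
  qscaleA qscale1 qscaleDr qscaleDl.

Let quot_proj_linear : linear quot_proj.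
Proof. by move=> c x y; rewrite projD -qscaleE. Qed.
HB.instance Definition _ :=
  GRing.isLinear.Build k V quotmod *:%R quot_proj quot_proj_linear.

Section Lift.
Context (W : lmodType k) (f : {linear V -> W}) (f0 : {in S, forall x, f x = 0}).

Definition quot_lift of {in S, forall x, f x = 0} := fun q : quotmod => f (repr q).

Lemma quot_liftE x : quot_lift f0 (quot_proj x) = f x.
Proof.
apply/eqP; rewrite -subr_eq0 -linearB; apply/eqP/f0.
by apply/quot_proj_eq; rewrite /quot_proj reprK.
Qed.

Let quot_lift_linear : linear (quot_lift f0).
Proof.
move=> c q r; case: (quot_proj_surj q) (quot_proj_surj r) => x -> [y ->].
by rewrite -linearP !quot_liftE linearP.
Qed.
HB.instance Definition _ :=
  GRing.isLinear.Build k quotmod W *:%R (quot_lift f0) quot_lift_linear.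

End Lift.

End QuotientModule.

Arguments quot_proj {k V} S.
Arguments quot_lift {k V S W f}.

Section Span.
Context (k : fieldType) (V : lmodType k) (R : V -> Prop).

Definition lspan (x : V) : bool :=
  `[< forall S : submodClosed V, (forall r, R r -> r \in S) -> x \in S >].

Lemma lspanP x :
  reflect (forall S : submodClosed V, (forall r, R r -> r \in S) -> x \in S)
          (x \in lspan).
Proof. exact: asboolP. Qed.

Lemma mem_lspan r : R r -> r \in lspan.
Proof. by move=> Rr; apply/lspanP => S; apply. Qed.

Let lspan_closed : subsemimod_closed lspan.
Proof.
split; first split.
- by apply/lspanP => S _; apply: rpred0.
- by move=> x y /lspanP xS /lspanP yS; apply/lspanP => S RS;
    rewrite rpredD ?xS ?yS.
- by move=> a x /lspanP xS; apply/lspanP => S RS; rewrite rpredZ ?xS.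
Qed.
HB.instance Definition _ := GRing.isSubmodClosed.Build k V lspan lspan_closed.
Definition lspan_submod := GRing.SubmodClosed.clone k V lspan _.

End Span.

Section Kernel.
Context (k : fieldType) (V W : lmodType k) (f : {linear V -> W}).

Definition lkernel (x : V) : bool := f x == 0.

Lemma lkernelE x : (x \in lkernel) = (f x == 0). Proof. by []. Qed.

Let lkernel_closed : subsemimod_closed lkernel.
Proof.
split; first split; rewrite ?lkernelE ?linear0 //.
- by move=> x y; rewrite !lkernelE linearD => /eqP-> /eqP->; rewrite addr0.
- by move=> a x; rewrite !lkernelE linearZ_LR => /eqP ->; rewrite scaler0.
Qed.
HB.instance Definition _ := GRing.isSubmodClosed.Build k V lkernel lkernel_closed.
Definition lkernel_submod := GRing.SubmodClosed.clone k V lkernel _.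

End Kernel.

Section Presentation.
Context (k : fieldType) (X : choiceType) (R : {freeg X / k} -> Prop).

Definition pres : Type := quotmod (lspan_submod R).
HB.instance Definition _ := GRing.Lmodule.on pres.

Definition gen (x : X) : pres := quot_proj (lspan_submod R) << 1 *g x >>.

Lemma gen_rel c x y z :
  R (<< 1 *g x >> - (c *: << 1 *g y >> + << 1 *g z >>)) ->
  gen x = c *: gen y + gen z.
Proof.
move=> Rxyz; transitivity
  (quot_proj (lspan_submod R) (c *: << 1 *g y >> + << 1 *g z >>)).
  by apply/quot_proj_eq; apply: (mem_lspan Rxyz).
exact: (linearP (quot_proj (lspan_submod R))).
Qed.

Section Lift.
Context (W : lmodType k) (phi : X -> W).

HB.instance Definition _ := GRing.isZmodMorphism.Build {freeg X / k} W
  (fglift phi) (lift_is_additive phi).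

Let fglift_scalable : scalable (fglift phi).
Proof.
move=> c D.
rewrite [c *: D](_ : _ = \sum_(x <- dom D) << c * coeff x D *g x >>); last first.
  rewrite -[D in LHS]freeg_sumE; apply/eqP/freeg_eqP => y.
  by rewrite coeffZ !raddf_sum mulr_sumr; apply: eq_bigr => x _;
     rewrite /= !coeffU mulrA.
rewrite -[D in RHS]freeg_sumE !raddf_sum.
by apply: eq_bigr => x _; rewrite /= !liftU scalerA.
Qed.
HB.instance Definition _ :=
  GRing.isScalable.Build k {freeg X / k} W *:%R (fglift phi) fglift_scalable.

Hypothesis phiR : forall r, R r -> fglift phi r = 0.

Lemma fglift_span : {in lspan R, forall x, fglift phi x = 0}.
Proof.
move=> x /lspanP xR; apply/eqP; rewrite -lkernelE.
by apply: (xR (lkernel_submod _)) => r /phiR r0; apply/eqP.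
Qed.

Definition pres_lift : {linear pres -> W} := quot_lift fglift_span.

Lemma pres_liftE x : pres_lift (gen x) = phi x.
Proof. by rewrite -[RHS]scale1r -liftU; apply: (quot_liftE fglift_span). Qed.

End Lift.

Lemma pres_ext (W : lmodType k) (f g : {linear pres -> W}) :
  (forall x, f (gen x) = g (gen x)) -> f = g.
Proof.
move=> fg; apply: linear_ext => q; case: (quot_proj_surj q) => D ->.
rewrite -[D]freeg_sumE !linear_sum /=; apply: eq_bigr => x _.
have -> : << coeff x D *g x >> = coeff x D *: << 1 *g x >> :> {freeg X / k}.
  by apply/eqP/freeg_eqP => y; rewrite coeffZ !coeffU mulrA mulr1.
by rewrite !linearZ_LR; congr (_ *: _); apply: fg.
Qed.

End Presentation.

Section Tensor.
Context (k : fieldType) (U V : lmodType k).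

Inductive bilinear_rel : {freeg (U * V)%type / k} -> Prop :=
| BilinearL c u u' v : bilinear_rel
    (<< 1 *g (c *: u + u', v) >> - (c *: << 1 *g (u, v) >> + << 1 *g (u', v) >>))
| BilinearR c u v v' : bilinear_rel
    (<< 1 *g (u, c *: v + v') >> - (c *: << 1 *g (u, v) >> + << 1 *g (u, v') >>)).

Definition tensor : Type := pres bilinear_rel.
HB.instance Definition _ := GRing.Lmodule.on tensor.

Definition tens (u : U) (v : V) : tensor := gen bilinear_rel (u, v).

Definition bilinear_map (W : lmodType k) (phi : U -> V -> W) :=
  (forall v, linear (phi^~ v)) /\ (forall u, linear (phi u)).

Section Lift.
Context (W : lmodType k) (phi : U -> V -> W) (phiL : bilinear_map phi).

Lemma tensor_lift_subproof r :
  bilinear_rel r -> fglift (fun p => phi p.1 p.2) r = 0.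
Proof.
by case=> [c u u' v|c u v v']; rewrite linearB linearP /= !liftU !scale1r /=
  ?(phiL.1 v) ?(phiL.2 u) subrr.
Qed.

Definition tensor_lift : {linear tensor -> W} := pres_lift tensor_lift_subproof.

Lemma tensor_liftE u v : tensor_lift (tens u v) = phi u v.
Proof. exact: pres_liftE. Qed.

End Lift.

Lemma tensor_ext (W : lmodType k) (f g : {linear tensor -> W}) :
  (forall u v, f (tens u v) = g (tens u v)) -> f = g.
Proof. by move=> fg; apply: pres_ext => -[u v]; apply: fg. Qed.

Lemma tens_linearl c u u' v :
  tens (c *: u + u') v = c *: tens u v + tens u' v.
Proof. exact: gen_rel (BilinearL c u u' v). Qed.

Lemma tens_linearr c u v v' :
  tens u (c *: v + v') = c *: tens u v + tens u v'.
Proof. exact: gen_rel (BilinearR c u v v'). Qed.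

End Tensor.

Section TensorPower.
Context (k : fieldType) (I : finType) (V : lmodType k).

Definition upd (x : {ffun I -> V}) (i : I) (v : V) : {ffun I -> V} :=
  [ffun j => if j == i then v else x j].

Inductive multilinear_rel : {freeg {ffun I -> V} / k} -> Prop :=
| MultilinearRel x i c v v' : multilinear_rel
    (<< 1 *g upd x i (c *: v + v') >>
     - (c *: << 1 *g upd x i v >> + << 1 *g upd x i v' >>)).

(* The tensor product of copies of V indexed by I. *)
Definition tpower : Type := pres multilinear_rel.
HB.instance Definition _ := GRing.Lmodule.on tpower.

Definition tpure (x : {ffun I -> V}) : tpower := gen multilinear_rel x.

Definition multilinear (W : lmodType k) (phi : {ffun I -> V} -> W) :=
  forall x i, linear (fun v => phi (upd x i v)).

Section Lift.
Context (W : lmodType k) (phi : {ffun I -> V} -> W) (phiL : multilinear phi).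

Lemma tpower_lift_subproof r : multilinear_rel r -> fglift phi r = 0.
Proof.
by case=> x i c v v'; rewrite linearB linearP /= !liftU !scale1r /= phiL subrr.
Qed.

Definition tpower_lift : {linear tpower -> W} := pres_lift tpower_lift_subproof.

Lemma tpower_liftE x : tpower_lift (tpure x) = phi x.
Proof. exact: pres_liftE. Qed.

End Lift.

Lemma tpower_ext (W : lmodType k) (f g : {linear tpower -> W}) :
  (forall x, f (tpure x) = g (tpure x)) -> f = g.
Proof. exact: pres_ext. Qed.

Lemma tpure_linear x i c v v' :
  tpure (upd x i (c *: v + v')) = c *: tpure (upd x i v) + tpure (upd x i v').
Proof. exact: gen_rel (MultilinearRel x i c v v'). Qed.

End TensorPower.

Section TensorOfPowers.
Context (k : fieldType) (I J : finType) (U V W : lmodType k).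
Local Notation TT := (tensor (tpower I U) (tpower J V)).

Lemma tens_tpure_multilinearl (f : {linear TT -> W}) T :
  multilinear (fun x => f (tens (tpure x) T)).
Proof. by move=> x i c v v'; rewrite tpure_linear tens_linearl linearP. Qed.

Lemma tens_tpure_multilinearr (f : {linear TT -> W}) T :
  multilinear (fun y => f (tens T (tpure y))).
Proof. by move=> x i c v v'; rewrite tpure_linear tens_linearr linearP. Qed.

Section Lift.
Variable phi : {ffun I -> U} -> {ffun J -> V} -> W.
Hypothesis phiL : forall y, multilinear (phi^~ y).
Hypothesis phiR : forall x, multilinear (phi x).

Let lift_right x : {linear tpower J V -> W} := tpower_lift (phiR x).

Let lift_right_multilinear : multilinear lift_right.
Proof.
move=> x i c v v'; apply: tpower_ext => y.
by rewrite linearDE linearZE !tpower_liftE phiL.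
Qed.

Let lift_left : {linear tpower I U -> {linear tpower J V -> W}} :=
  tpower_lift lift_right_multilinear.

Let lift_bilinear : bilinear_map (fun s t => lift_left s t).
Proof. by split=> [t c s s'|s c t t']; rewrite linearP. Qed.

Definition tpowers_lift : {linear TT -> W} := tensor_lift lift_bilinear.

Lemma tpowers_liftE x y : tpowers_lift (tens (tpure x) (tpure y)) = phi x y.
Proof. by rewrite tensor_liftE !tpower_liftE. Qed.

End Lift.

Section Curry.
Variable f : {linear TT -> W}.

Let curryl t := fun s => f (tens s t).
Let curryr s := fun t => f (tens s t).

Let curryl_linear t : linear (curryl t).
Proof. by move=> c s s'; rewrite /curryl tens_linearl linearP. Qed.
HB.instance Definition _ t :=
  GRing.isLinear.Build k (tpower I U) W *:%R (curryl t) (curryl_linear t).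

Let curryr_linear s : linear (curryr s).
Proof. by move=> c t t'; rewrite /curryr tens_linearr linearP. Qed.
HB.instance Definition _ s :=
  GRing.isLinear.Build k (tpower J V) W *:%R (curryr s) (curryr_linear s).

Lemma linear_tpowers0 :
  (forall x y, f (tens (tpure x) (tpure y)) = 0) -> f = 0.
Proof.
move=> f0; apply: tensor_ext => s t; rewrite linear0E.
have fx x : curryr (tpure x) = 0 :> {linear _ -> _}.
  by apply: tpower_ext => y; apply: f0.
have ft : curryl t = 0 :> {linear _ -> _}.
  by apply: tpower_ext => x; have /(congr1 (fun h : {linear _ -> _} => h t)) := fx x.
by have /(congr1 (fun h : {linear _ -> _} => h s)) := ft.
Qed.

End Curry.

Lemma tpowers_ext (f g : {linear TT -> W}) :
  (forall x y, f (tens (tpure x) (tpure y)) = g (tens (tpure x) (tpure y))) ->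
  f = g.
Proof.
move=> fg; apply/eqP; rewrite -subr_eq0; apply/eqP/linear_tpowers0 => x y.
by rewrite linearDE linearNE fg subrr.
Qed.

End TensorOfPowers.

Section Cohomology.
Context (k : fieldType) (C : nat -> lmodType k).
Context (d : forall n, {linear C n -> C n.+1}).

Definition cocycle n : Type := {x : C n | lkernel (d n) x}.
HB.instance Definition _ n := [isSub of cocycle n for @sval _ _].
HB.instance Definition _ n := [Choice of cocycle n by <:].
HB.instance Definition _ n :=
  GRing.SubChoice_isSubLmodule.Build k (C n) (lkernel (d n)) (cocycle n)
    (GRing.subsemimodClosedP (lkernel_submod (d n))).

Definition is_coboundary n : C n -> Prop :=
  match n with
  | 0 => fun x => x = 0
  | m.+1 => fun x => exists y, x = d m y
  end.

Definition coboundary n (z : cocycle n) : bool := `[< is_coboundary (val z) >].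

Let is_coboundary0 n : is_coboundary (0 : C n).
Proof. by case: n => [|n] //=; exists 0; rewrite linear0. Qed.

Let is_coboundaryD n (x y : C n) :
  is_coboundary x -> is_coboundary y -> is_coboundary (x + y).
Proof.
case: n x y => [|n] x y /=; first by move=> -> ->; rewrite addr0.
by move=> [x' ->] [y' ->]; exists (x' + y'); rewrite linearD.
Qed.

Let is_coboundaryZ n c (x : C n) : is_coboundary x -> is_coboundary (c *: x).
Proof.
case: n x => [|n] x /=; first by move=> ->; rewrite scaler0.
by move=> [x' ->]; exists (c *: x'); rewrite linearZ_LR.
Qed.

Let coboundary_closed n : subsemimod_closed (@coboundary n).
Proof.
split; first split.
- by apply/asboolP; rewrite raddf0; apply: is_coboundary0.
- by move=> x y /asboolP xb /asboolP yb; apply/asboolP; rewrite raddfD;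
    apply: is_coboundaryD.
- by move=> c x /asboolP xb; apply/asboolP; rewrite linearZ_LR;
    apply: is_coboundaryZ.
Qed.
HB.instance Definition _ n :=
  GRing.isSubmodClosed.Build k (cocycle n) (@coboundary n) (@coboundary_closed n).
Definition coboundary_submod n :=
  GRing.SubmodClosed.clone k (cocycle n) (@coboundary n) _.

(* The quotient of the n-cocycles by those among them that are coboundaries;
   when d n.+1 \o d n = 0 every coboundary is a cocycle. *)
Definition cohomology n : Type := quotmod (coboundary_submod n).
HB.instance Definition _ n := GRing.Lmodule.on (cohomology n).

End Cohomology.

HB.mixin Record isBimodule (k : fieldType) (A : algType k) M
    of GRing.Lmodule k M := {
  lact : A -> M -> M;
  ract : M -> A -> M;
  lact_bilinear : bilinear_map lact;
  ract_bilinear : bilinear_map ract;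
  lact1 : forall m, lact 1 m = m;
  ract1 : forall m, ract m 1 = m;
  lactA : forall a b m, lact (a * b) m = lact a (lact b m);
  ractA : forall m a b, ract m (a * b) = ract (ract m a) b;
  lractA : forall a m b, ract (lact a m) b = lact a (ract m b)
}.

#[short(type="bimodType")]
HB.structure Definition Bimodule (k : fieldType) (A : algType k) :=
  {M of GRing.Lmodule k M & isBimodule k A M}.

Section MultilinearSlot.
Context (k : fieldType) (I : finType) (V W W' : lmodType k).

Lemma multilinear_slot (phi : {ffun I -> V} -> W) (i : I)
    (F : W' -> {ffun I -> V}) :
  multilinear phi -> (forall v j, j != i -> F v j = F 0 j) ->
  linear (fun v => F v i) -> linear (fun v => phi (F v)).
Proof.
move=> phiL Fc Fi; have FE v : F v = upd (F 0) i (F v i).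
  by apply/ffunP => j; rewrite ffunE; case: eqVneq => [->|/Fc].
by move=> c v w; rewrite FE (Fi c v w) phiL -!FE.
Qed.

End MultilinearSlot.

(* The positions strictly above the diagonal of an n x n matrix; they index the
   factors of the tensor power of B of exponent n(n-1)/2. *)
Definition upair n : Type := {p : 'I_n * 'I_n | (p.1 < p.2)%N}.
HB.instance Definition _ n := Finite.on (upair n).

Lemma card_upair n : #|{: upair n}| = 'C(n, 2).
Proof.
rewrite card_sig -sum1_card -bin2_sum big_mkord.
transitivity (\sum_(j < n) \sum_(i < n | (i < j)%N) 1)%N.
  by rewrite (exchange_big_dep xpredT) //= pair_big_dep.
apply: eq_bigr => j _.
by rewrite -(big_ord_widen n (fun=> 1)%N (ltnW (ltn_ord j))) sum1_card card_ord.
Qed.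

Section LinearFun.
Context (k : fieldType) (U V : lmodType k).
Implicit Types f g : U -> V.

Lemma eq_linear_fun f g : f =1 g -> linear g -> linear f.
Proof. by move=> fg gL c x y; rewrite !fg gL. Qed.

Lemma linear_fun0 f : linear f -> f 0 = 0.
Proof. by move=> fL; have := fL (-1) 0 0; rewrite scaler0 addr0 scaleN1r addNr. Qed.

Lemma linear_funD f g : linear f -> linear g -> linear (fun x => f x + g x).
Proof. by move=> fL gL c x y; rewrite fL gL scalerDr addrACA. Qed.

Lemma linear_funZ (a : k) f : linear f -> linear (fun x => a *: f x).
Proof. by move=> fL c x y; rewrite fL scalerDr !scalerA mulrC. Qed.

Lemma linear_fun_sum (J : eqType) (r : seq J) (F : J -> U -> V) :
  (forall j, j \in r -> linear (F j)) -> linear (fun x => \sum_(j <- r) F j x).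
Proof.
move=> FL c x y; rewrite scaler_sumr -big_split /=.
by apply: eq_big_seq => j /FL ->.
Qed.

Lemma linear_fun_comp (W : lmodType k) (h : V -> W) f :
  linear h -> linear f -> linear (fun x => h (f x)).
Proof. by move=> hL fL c x y; rewrite fL hL. Qed.

End LinearFun.

Section SecondaryComplex.
Context (k : fieldType) (A : algType k) (B : comAlgType k).
Context (eps : {lrmorphism B -> A}) (M : bimodType A).

Definition secondary_tensor n : Type := tensor (tpower 'I_n A) (tpower (upair n) B).
HB.instance Definition _ n := GRing.Lmodule.on (secondary_tensor n).

(* The pure tensor with diagonal entries a i and entries b u v for u < v; the
   values of a and b outside of the index range are irrelevant. *)
Definition pure n (a : nat -> A) (b : nat -> nat -> B) : secondary_tensor n :=
  tens (tpure [ffun i : 'I_n => a i])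
       (tpure [ffun p : upair n => b (val p).1 (val p).2]).

Definition secondary_cochain n : Type := {linear secondary_tensor n -> M}.
HB.instance Definition _ n := GRing.Lmodule.on (secondary_cochain n).

(* Multiplication of row i into row i.-1 and of column i into column i.-1. *)
Definition merge_diag i (a : nat -> A) (b : nat -> nat -> B) (j : nat) : A :=
  if (j < i.-1)%N then a j
  else if j == i.-1 then eps (b i.-1 i) * a i.-1 * a i
  else a j.+1.

Definition merge_above i (b : nat -> nat -> B) (u v : nat) : B :=
  if (v < i.-1)%N then b u v
  else if v == i.-1 then b u i.-1 * b u i
  else if (u < i.-1)%N then b u v.+1
  else if u == i.-1 then b i.-1 v.+1 * b i v.+1
  else b u.+1 v.+1.

Definition secondary_delta_pure n (f : secondary_cochain n)
    (a : nat -> A) (b : nat -> nat -> B) : M :=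
  lact (a 0%N * eps (\prod_(1 <= v < n.+1) b 0%N v))
       (f (pure n (fun j => a j.+1) (fun u v => b u.+1 v.+1)))
  + \sum_(1 <= i < n.+1)
      (-1) ^+ i *: f (pure n (merge_diag i a b) (merge_above i b))
  + (-1) ^+ n.+1 *:
      ract (lact (eps (\prod_(0 <= u < n) b u n)) (f (pure n a b))) (a n).

(* The entries of a tensor matrix, with 1 outside of the index range. *)
Definition diag n (x : {ffun 'I_n -> A}) (j : nat) : A := oapp x 1 (insub j).
Definition above n (y : {ffun upair n -> B}) (u v : nat) : B :=
  oapp y 1 [pick p : upair n | ((val p).1 == u :> nat) && ((val p).2 == v :> nat)].

Lemma pureE n x y : pure n (diag x) (above y) = tens (tpure x) (tpure y).
Proof.
congr (tens (tpure _) (tpure _)); apply/ffunP => i; rewrite ffunE.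
  by rewrite /diag valK.
rewrite /above; case: pickP => [p /andP[/eqP p1 /eqP p2]|/(_ i)]; last first.
  by rewrite !eqxx.
congr (y _); apply: val_inj; rewrite [LHS]surjective_pairing.
by rewrite [RHS]surjective_pairing; congr (_, _); apply: val_inj.
Qed.

Lemma diagE n (a : nat -> A) j : (j < n)%N -> diag [ffun i : 'I_n => a i] j = a j.
Proof. by move=> jn; rewrite /diag insubT /= ffunE. Qed.

Lemma aboveE n (b : nat -> nat -> B) u v : (u < v < n)%N ->
  above [ffun p : upair n => b (val p).1 (val p).2] u v = b u v.
Proof.
move=> /andP[uv vn]; have un := ltn_trans uv vn.
rewrite /above; case: pickP => [p /andP[/eqP p1 /eqP p2]|].
  by rewrite /= ffunE p1 p2.
by move=> /(_ (exist _ (Ordinal un, Ordinal vn) uv)); rewrite !eqxx.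
Qed.

Lemma diag_upd n (x : {ffun 'I_n -> A}) i w :
  diag (upd x i w) = fun j => if j == i then w else diag x j.
Proof.
apply/funext => j; rewrite /diag; case: insubP => [l _ <-|jn] /=.
  by rewrite ffunE.
by case: eqP => // ji; rewrite ji ltn_ord in jn.
Qed.

Lemma above_upd n (y : {ffun upair n -> B}) p w :
  above (upd y p w) = fun u v =>
    if (u == (val p).1) && (v == (val p).2) then w else above y u v.
Proof.
apply/funext => u; apply/funext => v; rewrite /above.
case: pickP => [q /andP[/eqP <- /eqP <-]|q0] /=; last first.
  by have := q0 p; rewrite eq_sym [_ == v]eq_sym => ->.
rewrite ffunE -val_eqE /=; case: (val q) (val p) => [q1 q2] [p1 p2] /=.
by rewrite xpair_eqE.
Qed.

Lemma eq_pure n a a' b b' : (forall j, (j < n)%N -> a j = a' j) ->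
  (forall u v, (u < v < n)%N -> b u v = b' u v) -> pure n a b = pure n a' b'.
Proof.
move=> ea eb; congr (tens (tpure _) (tpure _)); apply/ffunP => i.
  by rewrite !ffunE ea.
by rewrite !ffunE eb //; case: i => -[i j] /= ->; rewrite ltn_ord.
Qed.


Section Multilinearity.
Variables (n : nat) (f : secondary_cochain n).

Lemma pure_linear_diag (V : lmodType k) (F : V -> nat -> A) b j0 : (j0 < n)%N ->
  (forall w j, (j < n)%N -> j != j0 -> F w j = F 0 j) -> linear (F^~ j0) ->
  linear (fun w => f (pure n (F w) b)).
Proof.
move=> j0n Fc FL; rewrite /pure; move: (tpure [ffun p => _]) => T.
apply: (multilinear_slot (i := Ordinal j0n)
  (F := fun w => [ffun i : 'I_n => F w i]) (tens_tpure_multilinearl f T)).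
- by move=> w j jj; rewrite !ffunE Fc.
- by move=> c v w; rewrite !ffunE FL.
Qed.

Lemma pure_linear_above (V : lmodType k) (G : V -> nat -> nat -> B) a u0 v0 :
  (u0 < v0 < n)%N ->
  (forall w u v, (u < v < n)%N -> (u != u0) || (v != v0) -> G w u v = G 0 u v) ->
  linear (fun w => G w u0 v0) -> linear (fun w => f (pure n a (G w))).
Proof.
move=> /andP[uv vn] Gc GL; have un := ltn_trans uv vn.
rewrite /pure; move: (tpure [ffun i => _]) => T.
pose p0 : upair n := exist _ (Ordinal un, Ordinal vn) uv.
apply: (multilinear_slot (i := p0)
  (F := fun w => [ffun p : upair n => G w (val p).1 (val p).2])
  (tens_tpure_multilinearr f T)).
- move=> w [[j1 j2] jP] jj; rewrite !ffunE /= Gc //; first by rewrite jP ltn_ord.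
  by move: jj; rewrite -val_eqE /= xpair_eqE negb_and.
- by move=> c v w; rewrite !ffunE GL.
Qed.

Let lactL m : linear (lact^~ m : A -> M). Proof. exact: lact_bilinear.1. Qed.
Let lactR a : linear (lact a : M -> M). Proof. exact: lact_bilinear.2. Qed.
Let ractL a : linear (ract^~ a : M -> M). Proof. exact: ract_bilinear.1. Qed.
Let ractR m : linear (ract m : A -> M). Proof. exact: ract_bilinear.2. Qed.

Lemma delta_pure_diag (a : nat -> A) b i0 : (i0 < n.+1)%N ->
  linear (fun w => secondary_delta_pure f (fun j => if j == i0 then w else a j) b).
Proof.
move=> i0n; rewrite /secondary_delta_pure; apply: linear_funD; first apply: linear_funD.
- case: i0 i0n => [|i0] i0n /=.
    by move=> c v w; rewrite mulrDl -scalerAl lactL.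
  apply: (linear_fun_comp (lactR _)); apply: (@pure_linear_diag _ _ _ i0) => //.
    by move=> w j _ /negPf; rewrite eqSS => ->.
  by move=> c v w; rewrite eqxx.
- apply: linear_fun_sum => -[|i]; rewrite mem_index_iota => /andP[// _ iN].
  apply: linear_funZ; rewrite /merge_diag /=.
  apply: (@pure_linear_diag _ _ _ (if (i0 <= i)%N then i0 else i0.-1)).
  + by case: ifP; lia.
  + move=> w j jn /eqP jj; have [ji|ij|ij] := ltngtP j i.
    * by case: eqP => // ji0; case: ifP jj; lia.
    * by case: eqP => // ji0; case: ifP jj; lia.
    * by do 2?[case: eqP => //] => *; case: ifP jj; lia.
  + move=> c v w; have [i0i|ii0|->] := ltngtP i0 i.
    * by rewrite i0i eqxx.
    * have [->|i0Si] := eqVneq i0 i.+1.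
        by rewrite /= ltnn !eqxx mulrDr -scalerAr.
      have -> : (i0.-1 < i)%N = false by lia.
      have -> : (i0.-1 == i) = false by lia.
      by have -> : i0.-1.+1 == i0 by lia.
    * rewrite ltnn !eqxx (_ : (i.+1 == i) = false); last by lia.
      by rewrite mulrDr mulrDl -scalerAr -scalerAl.
- apply: linear_funZ; have [ni|ni] := eqVneq n i0.
    rewrite (_ : (fun w => _) = fun w =>
      ract (lact (eps (\prod_(0 <= u < n) b u n)) (f (pure n a b))) w).
      exact: ractR.
    apply/funext => w; congr (ract (lact _ (f _)) _).
    by apply: eq_pure => // j jn; case: eqP => //; lia.
  apply: (linear_fun_comp (ractL _)); apply: (linear_fun_comp (lactR _)).
  apply: (@pure_linear_diag _ _ _ i0); first by lia.
    by move=> w j _ /negPf ->.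
  by move=> c v w; rewrite eqxx.
Qed.

Let prod_linear (s e v0 : nat) (c : nat -> B) : (s <= v0 < e)%N ->
  linear (fun w : B => \prod_(s <= v < e) (if v == v0 then w else c v)).
Proof.
move=> v0r; have v0i : v0 \in index_iota s e by rewrite mem_index_iota.
have E w : \prod_(s <= v < e) (if v == v0 then w else c v) =
    w * \prod_(s <= v < e | v != v0) c v.
  rewrite (bigD1_seq v0) ?iota_uniq //= eqxx; congr (_ * _).
  by apply: eq_bigr => v /negPf ->.
by move=> a x y; rewrite !E mulrDl -scalerAl.
Qed.

Lemma delta_pure_above a (b : nat -> nat -> B) u0 v0 : (u0 < v0 < n.+1)%N ->
  linear (fun w => secondary_delta_pure f a
    (fun u v => if (u == u0) && (v == v0) then w else b u v)).
Proof.
move=> /andP[uv0 v0n]; rewrite /secondary_delta_pure.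
apply: linear_funD; first apply: linear_funD.
- case: u0 uv0 => [|u0] uv0 /=.
    apply: (linear_fun_comp (lactL _)) => c v w.
    by rewrite prod_linear ?uv0 // linearP mulrDr -scalerAr.
  apply: (linear_fun_comp (lactR _)).
  apply: (@pure_linear_above _ _ _ u0 v0.-1); first by lia.
    by move=> w u v uv uv'; case: ifP => //; lia.
  by have -> : v0.-1.+1 == v0; [lia|rewrite eqxx].
- apply: linear_fun_sum => -[|i]; rewrite mem_index_iota => /andP[// _ iN].
  apply: linear_funZ; have [uvi|uvi] := boolP ((u0 == i) && (v0 == i.+1)).
    case/andP: uvi => /eqP u0i /eqP v0i; rewrite {}u0i {}v0i in uv0 v0n *.
    apply: (@eq_linear_fun _ _ _ _ (fun w =>
      f (pure n (fun j => if (j < i)%N then a j else if j == i then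
                            eps w * a i * a i.+1 else a j.+1)
           (merge_above i.+1 b)))); last first.
      apply: (@pure_linear_diag _ _ _ i) => //.
        by move=> w j _ /negPf ->.
      by move=> c v w; rewrite ltnn eqxx linearP !mulrDl -!scalerAl.
    move=> w /=; congr (f _); apply: eq_pure => [j jn|u v uv].
      by rewrite /merge_diag /= !eqxx.
    rewrite /merge_above /=; do ![case: ifP => ? //]; lia.
  apply: (@eq_linear_fun _ _ _ _ (fun w =>
      f (pure n (merge_diag i.+1 a b) (merge_above i.+1 (fun u v =>
           if (u == u0) && (v == v0) then w else b u v))))).
    move=> w /=; congr (f _); apply: eq_pure => // j _.
    rewrite /merge_diag /=; case: ifP => // _; case: ifP => // _.
    by case: ifP => //; lia.
  apply: (@pure_linear_above _ _ _ (if (u0 <= i)%N then u0 else u0.-1)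
           (if (v0 <= i)%N then v0 else v0.-1)).
  + by case: ifP; case: ifP; lia.
  + move=> w u v uv ne; rewrite /merge_above /=.
    have {}ne : (u = if (u0 <= i)%N then u0 else u0.-1) ->
                (v = if (v0 <= i)%N then v0 else v0.-1) -> False.
      by move=> eu ev; move: ne; rewrite -eu -ev !eqxx.
    do ![case: ifP => ? //]; case: ne; case: ifP => ?; lia.
  + { move=> c v w; rewrite /merge_above /=.
      case: (leqP u0 i) => ?; case: (leqP v0 i) => ?.
      all: repeat match goal with
        |- context [if ?e then _ else _] => case: (boolP e) => ? end.
      all: try by []; try lia.
      all: by rewrite ?mulrDl ?mulrDr -?scalerAl -?scalerAr. }
- apply: linear_funZ; have [v0E|v0E] := eqVneq v0 n.
    rewrite {}v0E in uv0 v0n *.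
    apply: (@eq_linear_fun _ _ _ _ (fun w =>
      ract (lact (eps (\prod_(0 <= u < n) (if u == u0 then w else b u n)))
             (f (pure n a b))) (a n))).
      move=> w /=; congr (ract (lact (eps _) (f _)) _).
        by apply: eq_bigr => u _; rewrite andbT.
      by apply: eq_pure => // u v uv; case: ifP => //; lia.
    apply: (linear_fun_comp (ractL _)); apply: (linear_fun_comp (lactL _)).
    by move=> c v w; rewrite prod_linear // linearP.
  apply: (@eq_linear_fun _ _ _ _ (fun w =>
      ract (lact (eps (\prod_(0 <= u < n) b u n))
             (f (pure n a (fun u v =>
                if (u == u0) && (v == v0) then w else b u v)))) (a n))).
    move=> w /=; congr (ract (lact (eps _) _) _).
    by apply: eq_bigr => u _; rewrite andbF.
  apply: (linear_fun_comp (ractL _)); apply: (linear_fun_comp (lactR _)).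
  apply: (@pure_linear_above _ _ _ u0 v0); first by lia.
    by move=> w u v _ ne; case: ifP => //; lia.
  by move=> c v w; rewrite !eqxx.
Qed.

End Multilinearity.

Lemma delta_multilinear_diag n (f : secondary_cochain n) (y : {ffun upair n.+1 -> B}) :
  multilinear (fun x : {ffun 'I_n.+1 -> A} =>
    secondary_delta_pure f (diag x) (above y)).
Proof.
move=> x i; apply: eq_linear_fun (delta_pure_diag f (diag x) _ (ltn_ord i)).
by move=> w; rewrite diag_upd.
Qed.

Lemma delta_multilinear_above n (f : secondary_cochain n) (x : {ffun 'I_n.+1 -> A}) :
  multilinear (fun y : {ffun upair n.+1 -> B} =>
    secondary_delta_pure f (diag x) (above y)).
Proof.
move=> y p; have pP : ((val p).1 < (val p).2 < n.+1)%N.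
  by rewrite (valP p) ltn_ord.
apply: eq_linear_fun (delta_pure_above f (diag x) (above y) pP).
by move=> w; rewrite above_upd.
Qed.

Definition secondary_delta n (f : secondary_cochain n) : secondary_cochain n.+1 :=
  tpowers_lift (delta_multilinear_diag f) (delta_multilinear_above f).

Lemma secondary_deltaE n (f : secondary_cochain n) (a : nat -> A) (b : nat -> nat -> B) :
  secondary_delta f (pure n.+1 a b) = secondary_delta_pure f a b.
Proof.
rewrite /secondary_delta tpowers_liftE /secondary_delta_pure.
congr (_ + _ + _).
- congr (lact (_ * eps _) (f _)).
  + by rewrite diagE.
  + apply: eq_big_nat => v /andP[v1 vn]; rewrite aboveE //; lia.
  + apply: eq_pure => [j jn|u v uv]; first by rewrite diagE.
    by rewrite aboveE //; lia.
- apply: eq_big_nat => -[//|i] /andP[_ iN]; congr (_ *: f _).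
  apply: eq_pure => [j jn|u v uv].
    rewrite /merge_diag /= !diagE ?aboveE //; lia.
  rewrite /merge_above /=; do ![case: ifP => ?]; rewrite !aboveE //; lia.
- congr (_ *: ract (lact (eps _) (f _)) _).
  + by apply: eq_big_nat => u /andP[u1 un]; rewrite aboveE //; lia.
  + apply: eq_pure => [j jn|u v uv]; first by rewrite diagE //; lia.
    by rewrite aboveE //; lia.
  + by rewrite diagE.
Qed.

Lemma secondary_cochain_ext n (f g : secondary_cochain n) :
  (forall a b, f (pure n a b) = g (pure n a b)) -> f = g.
Proof. by move=> fg; apply: tpowers_ext => x y; rewrite -pureE fg. Qed.

Let delta_linear n : linear (@secondary_delta n).
Proof.
move=> c f g; apply: secondary_cochain_ext => a b; rewrite linearDE linearZE !secondary_deltaE.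
have evalL x : linear (fun h : secondary_cochain n => h x) by [].
suff h : linear (fun h : secondary_cochain n => secondary_delta_pure h a b) by apply: h.
apply: linear_funD; first apply: linear_funD.
- exact: linear_fun_comp (lact_bilinear.2 _) (evalL _).
- by apply: linear_fun_sum => i _; apply: linear_funZ; apply: evalL.
- apply: linear_funZ.
  exact: linear_fun_comp (ract_bilinear.1 _)
           (linear_fun_comp (lact_bilinear.2 _) (evalL _)).
Qed.
HB.instance Definition _ n :=
  GRing.isLinear.Build k (secondary_cochain n) (secondary_cochain n.+1) *:%R
    (@secondary_delta n) (@delta_linear n).

Definition secondary_cohomology n : Type :=
  cohomology (fun n =>
    @secondary_delta n : {linear secondary_cochain n -> secondary_cochain n.+1}) n.
HB.instance Definition _ n := GRing.Lmodule.on (secondary_cohomology n).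

(* A bimodule over the B-algebra A has to be B-symmetric for the composite of two
   consecutive differentials to vanish: this is already forced in degree 0. *)
Lemma secondary_delta2_symmetric :
  (forall f : secondary_cochain 0, secondary_delta (secondary_delta f) = 0) ->
  forall b m, lact (eps b) m = ract m (eps b) :> M.
Proof.
move=> dd0 b m.
have noI (x : 'I_0) : False by case: x.
have noU (p : upair 0) : False by case: p => -[x].
pose f : secondary_cochain 0 := tpowers_lift
  (phi := fun (_ : {ffun 'I_0 -> A}) (_ : {ffun upair 0 -> B}) => m)
  (fun _ _ i => False_ind _ (noI i)) (fun _ _ p => False_ind _ (noU p)).
have fE a c : f (pure 0 a c) = m by apply: tpowers_liftE.
have gE a c : secondary_delta f (pure 1 a c) = lact (a 0%N) m - ract m (a 0%N).
  rewrite secondary_deltaE /secondary_delta_pure !fE !big_geq // addr0.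
  by rewrite rmorph1 mulr1 lact1 expr1 scaleN1r.
have /(congr1 (fun h : secondary_cochain 2 =>
  h (pure 2 (fun _ => 1) (fun _ _ => b)))) := dd0 f.
rewrite secondary_deltaE /secondary_delta_pure !gE lact1 ract1 subrr.
have lact0 a : lact a (0 : M) = 0.
  exact: linear_fun0 (lact_bilinear.2 a).
have ract0 a : ract (0 : M) a = 0.
  exact: linear_fun0 (ract_bilinear.1 a).
rewrite !lact0 ract0 scaler0 add0r addr0 big_nat1 expr1 gE /merge_diag /=.
by rewrite !mulr1 scaleN1r => /eqP; rewrite oppr_eq0 subr_eq0 => /eqP.
Qed.

End SecondaryComplex.

Arguments secondary_tensor {k} A B n.
Arguments pure {k A B} n a b.
Arguments secondary_cochain {k A} B M n.
Arguments secondary_delta {k A B} eps {M} n f.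
Arguments secondary_cohomology {k A B} eps M n.

(* Main.v *)
Require Import Defs.
From mathcomp Require Import all_boot all_algebra.
From mathcomp Require Import zify.
From mathcomp Require boolp.

Import GRing.Theory.
Local Open Scope ring_scope.

(** The differential is the alternating sum of [n + 2] coface operators: the
    leftmost one lets the first row of the tensor matrix act on the value of the
    cochain, the inner ones precompose with the merging of two adjacent rows and
    columns, and the rightmost one lets the last column act.  Hence it suffices to
    know that these operators satisfy the cosimplicial identities
    [d^j d^i = d^i d^(j-1)] for [i < j]; in the double sum expressing two
    consecutive differentials, each term with [i < j] then cancels against the
    term with indices [(i, j-1)] in the other order ([alternating_sum2_eq0]).

    The identities between two inner cofaces say that merging adjacent rows and
    columns is associative ([coface_inner_inner]).  Those between an inner and an
    outer coface say that the product of the entries of a row or column does not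
    change when two of its entries are multiplied together ([prod_merge]), or, when
    the merged pair contains the acting row or column, that the two actions combine
    into one.  In the process entries of [B] are permuted and moved past diagonal
    entries: [B] has to be commutative and its image in [A] central.  For
    the last two columns ([coface_last_last]) an element of [B] must moreover be
    carried from one side of [M] to the other, and this is where the symmetry of
    [M] over [B] enters. *)

(** * Alternating double sums *)

(** By induction on [N]: passing from [N] to [N + 1] adds the terms [g (N + 1) i]
    and the terms [g j N], and the hypothesis pairs them with opposite signs. *)
Lemma alternating_sum2_eq0 (R : pzRingType) (V : lmodType R)
    (g : nat -> nat -> V) N :
  (forall i j, (i < j <= N)%N -> g j i = g i j.-1) ->
  \sum_(0 <= j < N.+1) \sum_(0 <= i < N) (-1) ^+ (j + i) *: g j i = 0.
Proof.
elim: N => [|N IH] gE; first by rewrite big_nat1 big_geq.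
rewrite big_nat_recr //=.
under eq_bigr => j _ do rewrite big_nat_recr //=.
rewrite big_split /= IH ?add0r; last by move=> i j ij; apply: gE; lia.
rewrite -big_split big_nat_cond big1 //= => i; rewrite andbT => iN.
rewrite (gE i N.+1) ?ltnS ?leqnn ?andbT //=.
by rewrite addSn exprS mulN1r scaleNr addnC subrr.
Qed.

(** * Products of merged entries *)

Lemma prod_merge (R : comPzRingType) (c : nat -> R) p n : (p < n)%N ->
  \prod_(0 <= u < n)
     (if (u < p)%N then c u else if u == p then c p * c p.+1 else c u.+1) =
  \prod_(0 <= u < n.+1) c u.
Proof.
move=> pn.
rewrite (big_cat_nat (n := p)) ?(ltnW pn) //= (big_ltn (m := p)) // ltnn eqxx.
rewrite (big_cat_nat (n := p) (p := n.+1)) //=; last by lia.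
rewrite (big_ltn (m := p) (n := n.+1)) ?(big_ltn (m := p.+1) (n := n.+1)); try lia.
rewrite -!mulrA; congr (_ * (_ * (_ * _))).
  by apply: eq_big_nat => u /andP[_ ->].
rewrite [RHS]big_add1 /=; apply: eq_big_nat => u /andP[pu _].
have -> : (u < p)%N = false by lia.
by have -> : (u == p) = false by lia.
Qed.

Section Cofaces.
Context (k : fieldType) (A : algType k) (B : comAlgType k).
Context (eps : {lrmorphism B -> A}) (M : bimodType A).

Implicit Types (a : nat -> A) (b : nat -> nat -> B).
Implicit Types (F : (nat -> A) -> (nat -> nat -> B) -> M).

(** * Coface operators *)

(** Cochains enter only through their values on pure tensors, so the cofaces act
    on arbitrary functions of the families of entries. *)
Definition coface n i F a b : M :=
  if i == 0%N then
    lact (a 0%N * eps (\prod_(1 <= v < n.+1) b 0%N v))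
      (F (fun j => a j.+1) (fun u v => b u.+1 v.+1))
  else if i == n.+1 then
    ract (lact (eps (\prod_(0 <= u < n) b u n)) (F a b)) (a n)
  else F (merge_diag eps i a b) (merge_above i b).

Lemma coface_first n F a b : coface n 0 F a b =
  lact (a 0%N * eps (\prod_(1 <= v < n.+1) b 0%N v))
      (F (fun j => a j.+1) (fun u v => b u.+1 v.+1)).
Proof. by []. Qed.

Lemma coface_last n F a b : coface n n.+1 F a b =
  ract (lact (eps (\prod_(0 <= u < n) b u n)) (F a b)) (a n).
Proof. by rewrite /coface eqxx. Qed.

Lemma coface_inner n i F a b : (0 < i < n.+1)%N ->
  coface n i F a b = F (merge_diag eps i a b) (merge_above i b).
Proof. by case: i => [//|i] iN; rewrite /coface /= ifN //; lia. Qed.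

Lemma delta_cofaceE n (f : secondary_cochain B M n) a b :
  secondary_delta eps n f (pure n.+1 a b) =
  \sum_(0 <= i < n.+2) (-1) ^+ i *: coface n i (fun a b => f (pure n a b)) a b.
Proof.
rewrite secondary_deltaE /secondary_delta_pure [RHS]big_nat_recr //= [in RHS]big_ltn //.
rewrite expr0 scale1r coface_last; congr (_ + _ + _).
by apply: eq_big_nat => i iN; rewrite coface_inner.
Qed.

Let lactL (a : A) : linear (lact a : M -> M). Proof. exact: lact_bilinear.2. Qed.
Let ractL (a : A) : linear (ract^~ a : M -> M). Proof. exact: ract_bilinear.1. Qed.

Lemma coface_sum n j (r : seq nat) (c : nat -> k) (F : nat -> _) a b :
  coface n j (fun a b => \sum_(i <- r) c i *: F i a b) a b =
  \sum_(i <- r) c i *: coface n j (F i) a b.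
Proof.
have lin_sum (h : M -> M) (x : nat -> M) : linear h ->
    h (\sum_(i <- r) c i *: x i) = \sum_(i <- r) c i *: h (x i).
  move=> hL; elim: r => [|i r IH]; first by rewrite !big_nil (linear_fun0 hL).
  by rewrite !big_cons hL IH.
rewrite /coface; case: ifP => _; first exact: lin_sum.
case: ifP => // _; rewrite (lin_sum _ _ (lactL _)).
exact: lin_sum (ractL _).
Qed.

(** * Cosimplicial identities *)

(** The values on pure tensors of a cochain of degree [n] satisfy this; the
    merging operations produce families that agree only on these entries. *)
Definition local n F := forall a a' b b', (forall j, (j < n)%N -> a j = a' j) ->
  (forall u v, (u < v < n)%N -> b u v = b' u v) -> F a b = F a' b'.

Hypothesis eps_central : forall (b : B) (x : A), GRing.comm (eps b) x.
Variables (n : nat) (F : (nat -> A) -> (nat -> nat -> B) -> M).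
Hypothesis FE : local n F.

(** Away from [j = i + 1] the two mergings concern disjoint pairs; for [j = i + 1]
    both sides merge three consecutive rows and columns. *)
Lemma coface_inner_inner i j a b : (0 < i < j)%N -> (j < n.+2)%N ->
  coface n.+1 j (coface n i F) a b = coface n.+1 i (coface n j.-1 F) a b.
Proof.
case: i j => [//|i] [//|[//|j]] /andP[_ ij] jn; rewrite !ltnS in ij.
rewrite !coface_inner /=; try lia.
apply: FE => [l ln|u v uv].
  rewrite /merge_diag /merge_above /=.
  repeat match goal with
    |- context [if ?e then _ else _] => case: (boolP e) => ? end.
  all: try by []; try lia.
  (* three consecutive diagonal entries merged into one *)
  have <- : i = j by lia.
  rewrite !mulrA -(mulrA _ (a i)) -(eps_central _ (a i)) !mulrA -!rmorphM.
  by rewrite -(mulrA (b i _)) (mulrC (b i _)).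
rewrite /merge_above /=.
repeat match goal with
  |- context [if ?e then _ else _] => case: (boolP e) => ? end.
all: try by []; try lia.
(* the entry where the merged pair of rows meets the merged pair of columns *)
all: try by rewrite mulrACA.
(* three consecutive entries of one row or column merged into one *)
all: by have <- : i = j by [lia]; rewrite mulrA.
Qed.

Lemma coface_inner_first j a b : (1 < j < n.+2)%N ->
  coface n.+1 j (coface n 0 F) a b = coface n.+1 0 (coface n j.-1 F) a b.
Proof.
case: j => [//|[//|j]] jn.
rewrite coface_inner ?coface_first ?coface_inner //=.
(* Discarding the first row and column commutes with merging by computation. *)
congr (lact (_ * eps _) _).
rewrite [RHS]big_add1 big_add1 /= -(@prod_merge _ _ j); last by lia.
apply: eq_bigr => u _; rewrite /merge_above /= !ltnS eqSS.
do ![case: ifP => ? //]; lia.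
Qed.

(** Merging the first two rows makes both of them act at once. *)
Lemma coface_first_first a b :
  coface n.+1 1 (coface n 0 F) a b = coface n.+1 0 (coface n 0 F) a b.
Proof.
rewrite coface_inner // !coface_first -lactA; congr (lact _ _).
rewrite (_ : \prod_(1 <= v < n.+1) merge_above 1 b 0 v =
    \prod_(1 <= v < n.+1) b 0%N v.+1 * \prod_(1 <= v < n.+1) b 1%N v.+1); last first.
  by rewrite -big_split; apply: eq_big_nat => -[].
rewrite [\prod_(1 <= v < n.+2) _]big_nat_recl // !rmorphM /merge_diag /=.
rewrite (eps_central _ (a 0%N)) -!mulrA; congr (_ * (_ * _)).
by rewrite !mulrA eps_central.
Qed.

(** The left and right actions commute; the corner entry [b 0 (n + 1)] belongs to
    whichever of the first row and the last column acts last. *)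
Lemma coface_last_first a b :
  coface n.+1 n.+2 (coface n 0 F) a b = coface n.+1 0 (coface n n.+1 F) a b.
Proof.
rewrite coface_last !coface_first coface_last -!lractA -!lactA.
congr (ract (lact _ _) _); rewrite eps_central -!mulrA -!rmorphM.
congr (_ * eps _); rewrite [\prod_(0 <= u < n.+1) _]big_nat_recl //.
by rewrite [\prod_(1 <= v < n.+2) _]big_nat_recr //= mulrA.
Qed.

(** The last column of the merged matrix is obtained from the one of the original
    matrix by multiplying two adjacent entries, which preserves its product. *)
Lemma coface_last_inner i a b : (0 < i < n.+1)%N ->
  coface n.+1 n.+2 (coface n i F) a b = coface n.+1 i (coface n n.+1 F) a b.
Proof.
case: i => [//|i] iN.
rewrite coface_last coface_inner // [RHS]coface_inner; last by lia.
rewrite coface_last; congr (ract (lact (eps _) _) _).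
  rewrite -(@prod_merge _ _ i); last by lia.
  apply: eq_big_nat => u uN; rewrite /merge_above /=.
  have -> : (n < i)%N = false by lia.
  by have -> : (n == i) = false by lia.
rewrite /merge_diag /=; do ![case: ifP => ? //]; lia.
Qed.

(** Both sides let the last two columns act.  When they are merged, the entry in
    position [(n, n + 1)] becomes a factor of the last diagonal entry, which acts on
    the right of [M]; otherwise it acts with the last column, on the left. *)
Lemma coface_last_last a b :
  (forall (b : B) (m : M), lact (eps b) m = ract m (eps b)) ->
  coface n.+1 n.+2 (coface n n.+1 F) a b =
  coface n.+1 n.+1 (coface n n.+1 F) a b.
Proof.
move=> M_sym; rewrite !coface_last [RHS]coface_inner ?leqnn // coface_last.
rewrite /merge_diag /= ltnn eqxx !ractA; congr (ract _ _).
rewrite big_nat_recr //= (_ : \prod_(0 <= u < n) merge_above n.+1 b u n =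
    \prod_(0 <= u < n) b u n * \prod_(0 <= u < n) b u n.+1); last first.
  rewrite -big_split; apply: eq_big_nat => u _.
  by rewrite /merge_above /= ltnn eqxx.
rewrite -!lractA; congr (ract _ _).
rewrite [F _ (merge_above _ _)](FE _ a _ b); first last.
- by move=> u v /andP[_ vn]; rewrite /merge_above /= vn.
- by move=> j jn; rewrite jn.
rewrite -M_sym -!lactA -!rmorphM; congr (lact (eps _) _).
by rewrite mulrC mulrA mulrC.
Qed.

Lemma coface_cosimplicial i j a b :
  (forall (b : B) (m : M), lact (eps b) m = ract m (eps b)) ->
  (i < j <= n.+2)%N ->
  coface n.+1 j (coface n i F) a b = coface n.+1 i (coface n j.-1 F) a b.
Proof.
move=> M_sym /andP[ij]; rewrite leq_eqVlt => /predU1P[jE|jn].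
  subst j; case: i ij => [|i] ij; first exact: coface_last_first.
  have [->|iN] := eqVneq i n; first exact: coface_last_last.
  by apply: coface_last_inner; lia.
case: i ij => [|i] ij; last by apply: coface_inner_inner; rewrite ?ij.
case: j ij jn => [//|[|j]] _ jn; first exact: coface_first_first.
exact: coface_inner_first.
Qed.

End Cofaces.

Arguments coface {k A B} eps {M} n i F a b.
Arguments local {k A B M} n F.
Arguments coface_cosimplicial {k A B eps M} eps_central {n F}.

Theorem proposition3p1 (k : fieldType) (A : algType k) (B : comAlgType k)
    (eps : {lrmorphism B -> A}) (M : bimodType A)
    (eps_central : forall (b : B) (a : A), GRing.comm (eps b) a)
    (M_sym : forall (b : B) (m : M), lact (eps b) m = ract m (eps b))
    (n : nat) (f : secondary_cochain B M n) :
  secondary_delta eps n.+1 (secondary_delta eps n f) = 0.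
Proof.
apply: secondary_cochain_ext => a b; rewrite linear0E delta_cofaceE.
pose F (a : nat -> A) (b : nat -> nat -> B) := f (pure n a b).
have FE : local n F by move=> a1 a2 b1 b2 a12 b12; congr (f _); apply: eq_pure.
rewrite -[RHS](@alternating_sum2_eq0 _ _ (fun j i =>
  coface eps n.+1 j (coface eps n i F) a b) n.+2); last first.
  by move=> i j ij; apply: (coface_cosimplicial eps_central FE).
apply: eq_bigr => j _.
rewrite (_ : (fun _ _ => _) = fun a b =>
  \sum_(0 <= i < n.+2) (-1) ^+ i *: coface eps n i F a b); last first.
  by apply/boolp.funext => a1; apply/boolp.funext => b1; rewrite delta_cofaceE.
rewrite coface_sum scaler_sumr; apply: eq_bigr => i _.
by rewrite scalerA exprD.
Qed.
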